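(* (ii) If $A$ is a commutative unitary ring with at most $5$ ideals, then its residuated lattice of ideals $(\mathrm{Id}(A),\cap,+,\otimes,\rightarrow,\{0\},A)$ is a divisible residuated lattice. (iii) Let $A=A_1\times\dots\times A_q$ be a direct product of commutative unitary rings such that, for each $i\in\{1,2,\dots,q\}$, the number $n_{A_i}$ of ideals of $A_i$ belongs to $\{2,3,5\}$. Then $A$ is a principal ideal ring (every ideal of $A$ is principal), and therefore a multiplication ring.
   Context: A residuated lattice is an algebra $(L,\wedge,\vee,\odot,\rightarrow,0,1)$ such that $(L,\wedge,\vee,0,1)$ is a bounded lattice with order $\leq$, $(L,\odot,1)$ is a commutative ordered monoid, and $z\leq x\rightarrow y$ iff $x\odot z\leq y$ for all $x,y,z\in L$. It is divisible if $x\odot(x\rightarrow y)=x\wedge y$ for all $x,y\in L$. For a commutative unitary ring $A$, the set $\mathrm{Id}(A)$ of ideals of $A$, ordered by inclusion, is a residuated lattice with meet $I\cap J$, join $I+J$, product $I\otimes J=\{\sum_{k=1}^n i_kj_k : i_k\in I, j_k\in J\}$, residuum $I\rightarrow J=(J:I)=\{x\in A: xI\subseteq J\}$, least element $\{0\}$ and greatest element $A$. An ideal $I$ of $A$ is a multiplication ideal if for every ideal $J\subseteq I$ there exists an ideal $K$ of $A$ such that $J=I\otimes K$. The ring $A$ is a multiplication ring if all its ideals are multiplication ideals. Ideals are counted including $\{0\}$ and the whole ring. *)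

(* Defs.v *)
From HB Require Import structures.
From mathcomp Require Import all_boot all_order all_algebra.
From mathcomp Require Import boolp classical_sets functions cardinality.

Set Implicit Arguments.
Unset Strict Implicit.
Unset Printing Implicit Defensive.

Import Order.TTheory GRing.Theory.

Local Open Scope classical_set_scope.
Local Open Scope ring_scope.

Section ResiduatedLattice.
Context {d : Order.disp_t} {L : tbLatticeType d}.
Implicit Types (mul imp : L -> L -> L).

Record residuated_lattice mul imp : Prop := ResiduatedLattice {
  residuated_mulA : associative mul;
  residuated_mulC : commutative mul;
  residuated_mul1 : left_id \top%O mul;
  residuated_le_mul : forall z x y, (x <= y)%O -> (mul z x <= mul z y)%O;
  residuatedP : forall x y z, (z <= imp x y)%O <-> (mul x z <= y)%O
}.

Record divisible_residuated_lattice mul imp : Prop :=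
  DivisibleResiduatedLattice {
  divisible_residuated : residuated_lattice mul imp;
  divisibleP : forall x y, mul x (imp x y) = (x `&` y)%O
}.

End ResiduatedLattice.

(* [comPzRingType] does not exclude the zero ring, and [ideal A] contains
   both the zero ideal and the whole ring. *)
Record is_ideal (A : comPzRingType) (I : set A) : Prop := IsIdeal {
  is_ideal0 : I 0;
  is_idealD : forall x y, I x -> I y -> I (x + y);
  is_idealM : forall a x, I x -> I (a * x)
}.

Record ideal (A : comPzRingType) := Ideal {
  ideal_set :> set A;
  ideal_setP : is_ideal ideal_set
}.

HB.instance Definition _ (A : comPzRingType) := gen_eqMixin (ideal A).
HB.instance Definition _ (A : comPzRingType) := gen_choiceMixin (ideal A).

Section IdealOperations.
Variable A : comPzRingType.
Implicit Types I J K : ideal A.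

Lemma ideal0 I : ideal_set I 0. Proof. exact: is_ideal0 (ideal_setP I). Qed.

Lemma idealD I x y : ideal_set I x -> ideal_set I y -> ideal_set I (x + y).
Proof. exact: is_idealD (ideal_setP I) x y. Qed.

Lemma idealM I a x : ideal_set I x -> ideal_set I (a * x).
Proof. exact: is_idealM (ideal_setP I) a x. Qed.

Lemma ideal_inj I J : (I : set A) = J -> I = J.
Proof.
case: I J => [I hI] [J hJ] /= eIJ; case: J / eIJ hJ => hJ.
by congr Ideal; apply: Prop_irrelevance.
Qed.

Lemma ideal_zero_subproof : is_ideal [set 0 : A].
Proof.
by split=> [//|x y /= -> ->|a x /= ->]; rewrite ?addr0 ?mulr0.
Qed.
Definition ideal_zero : ideal A := Ideal ideal_zero_subproof.

Lemma ideal_full_subproof : is_ideal [set: A]. Proof. by []. Qed.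
Definition ideal_full : ideal A := Ideal ideal_full_subproof.

Lemma ideal_cap_subproof I J : is_ideal (I `&` J).
Proof.
split=> [|x y [Ix Jx] [Iy Jy]|a x [Ix Jx]].
- by split; apply: ideal0.
- by split; apply: idealD.
- by split; apply: idealM.
Qed.
Definition ideal_cap I J : ideal A := Ideal (ideal_cap_subproof I J).

Lemma ideal_sum_subproof I J : is_ideal [set i + j | i in I & j in J].
Proof.
split.
- by exists 0; [exact: ideal0|exists 0; [exact: ideal0|rewrite addr0]].
- move=> _ _ [i Ii [j Jj <-]] [i' Ii' [j' Jj' <-]].
  exists (i + i'); first exact: idealD.
  by exists (j + j'); [exact: idealD|rewrite addrACA].
- move=> a _ [i Ii [j Jj <-]]; exists (a * i); first exact: idealM.
  by exists (a * j); [exact: idealM|rewrite mulrDr].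
Qed.
Definition ideal_sum I J : ideal A := Ideal (ideal_sum_subproof I J).

Lemma ideal_mul_subproof I J :
  is_ideal [set x | exists n (i j : 'I_n -> A),
    [/\ forall k, ideal_set I (i k), forall k, ideal_set J (j k)
      & x = \sum_(k < n) i k * j k]].
Proof.
split.
- by exists 0%N, (fun=> 0), (fun=> 0); split=> [[]|[]|] //; rewrite big_ord0.
- move=> _ _ [m [i [j [Ii Jj ->]]]] [n [i' [j' [Ii' Jj' ->]]]].
  pose glue (f : 'I_m -> A) (g : 'I_n -> A) (k : 'I_(m + n)) :=
    match fintype.split k with inl l => f l | inr l => g l end.
  exists (m + n)%N, (glue i i'), (glue j j'); split.
  + by move=> k; rewrite /glue; case: fintype.split.
  + by move=> k; rewrite /glue; case: fintype.split.
  + rewrite big_split_ord /=; congr (_ + _); apply: eq_bigr => k _.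
      by rewrite /glue (unsplitK (inl k)).
    by rewrite /glue (unsplitK (inr k)).
- move=> a _ [n [i [j [Ii Jj ->]]]].
  exists n, (fun k => a * i k), j; split=> // [k|]; first exact: idealM.
  by rewrite mulr_sumr; apply: eq_bigr => k _; rewrite mulrA.
Qed.
Definition ideal_mul I J : ideal A := Ideal (ideal_mul_subproof I J).

Lemma ideal_imp_subproof I J :
  is_ideal [set x | forall i, ideal_set I i -> ideal_set J (x * i)].
Proof.
split=> [i Ii|x y hx hy i Ii|a x hx i Ii].
- by rewrite mul0r; exact: ideal0.
- by rewrite mulrDl; apply: idealD; [exact: hx|exact: hy].
- by rewrite -mulrA; apply: idealM; exact: hx.
Qed.
(* The colon ideal (J : I). *)
Definition ideal_imp I J : ideal A := Ideal (ideal_imp_subproof I J).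

Definition ideal_le I J : bool := `[< I `<=` J >].

Lemma ideal_le_refl : reflexive ideal_le.
Proof. by move=> I; apply/asboolP. Qed.

Lemma ideal_le_anti : antisymmetric ideal_le.
Proof.
by move=> I J /andP[/asboolP sIJ /asboolP sJI]; apply/ideal_inj/seteqP.
Qed.

Lemma ideal_le_trans : transitive ideal_le.
Proof.
move=> J I K /asboolP sIJ /asboolP sJK; apply/asboolP.
exact: subset_trans sIJ sJK.
Qed.

Lemma ideal_capC : commutative ideal_cap.
Proof. by move=> I J; apply: ideal_inj; rewrite /= setIC. Qed.

Lemma ideal_capA : associative ideal_cap.
Proof. by move=> I J K; apply: ideal_inj; rewrite /= setIA. Qed.

Lemma ideal_sumC : commutative ideal_sum.
Proof.
suff sub I J : ideal_sum I J `<=` ideal_sum J I.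
  by move=> I J; apply/ideal_inj/seteqP; split; exact: sub.
by move=> _ [i Ii [j Jj <-]]; exists j => //; exists i; rewrite // addrC.
Qed.

Lemma ideal_sumA : associative ideal_sum.
Proof.
move=> I J K; apply/ideal_inj/seteqP; split=> [_ [i Ii [_ [j Jj [k Kk <-]] <-]]
  |_ [_ [i Ii [j Jj <-]] [k Kk <-]]].
- exists (i + j); first by exists i => //; exists j.
  by exists k; rewrite // addrA.
- exists i => //; exists (j + k); last by rewrite addrA.
  by exists j => //; exists k.
Qed.

Lemma ideal_sumKI J I : ideal_cap I (ideal_sum I J) = I.
Proof.
apply/ideal_inj/seteqP; split=> [x []//|x Ix]; split=> //.
by exists x => //; exists 0; [exact: ideal0|rewrite addr0].
Qed.

Lemma ideal_capKU J I : ideal_sum I (ideal_cap I J) = I.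
Proof.
apply/ideal_inj/seteqP; split=> [_ [i Ii [j [Ij _] <-]]|x Ix].
  exact: idealD.
exists x => //; exists 0; last by rewrite addr0.
exact: ideal0 (ideal_cap I J).
Qed.

Lemma ideal_leEcap I J : ideal_le I J = (ideal_cap I J == I).
Proof.
apply/asboolP/eqP => [/setIidPl sIJ|eI]; first exact: ideal_inj.
by apply/setIidPl; rewrite -[RHS](congr1 (@ideal_set A) eI).
Qed.

Lemma ideal_zero_le I : ideal_le ideal_zero I.
Proof. by apply/asboolP => _ ->; exact: ideal0. Qed.

Lemma ideal_le_full I : ideal_le I ideal_full.
Proof. exact/asboolP. Qed.

End IdealOperations.

Fact ideal_display : Order.disp_t. Proof. exact: Order.Disp tt tt. Qed.

HB.instance Definition _ (A : comPzRingType) :=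
  Order.Le_isPOrder.Build ideal_display (ideal A)
    (@ideal_le_refl A) (@ideal_le_anti A) (@ideal_le_trans A).
HB.instance Definition _ (A : comPzRingType) :=
  Order.POrder_isLattice.Build ideal_display (ideal A)
    (@ideal_capC A) (@ideal_sumC A) (@ideal_capA A) (@ideal_sumA A)
    (@ideal_sumKI A) (@ideal_capKU A) (@ideal_leEcap A).
HB.instance Definition _ (A : comPzRingType) :=
  Order.hasBottom.Build ideal_display (ideal A) (@ideal_zero_le A).
HB.instance Definition _ (A : comPzRingType) :=
  Order.hasTop.Build ideal_display (ideal A) (@ideal_le_full A).

Section IdealOrder.
Variable A : comPzRingType.
Implicit Types I J : ideal A.

Lemma ideal_leE I J : (I <= J)%O = `[< I `<=` J >]. Proof. by []. Qed.
Lemma ideal_meetE I J : (I `&` J)%O = ideal_cap I J. Proof. by []. Qed.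
Lemma ideal_joinE I J : (I `|` J)%O = ideal_sum I J. Proof. by []. Qed.
Lemma ideal_bottomE : \bot%O = ideal_zero A. Proof. by []. Qed.
Lemma ideal_topE : \top%O = ideal_full A. Proof. by []. Qed.

End IdealOrder.

Section RingPredicates.
Variable A : comPzRingType.
Implicit Types I J K : ideal A.

Definition at_most_ideals (n : nat) : Prop := ([set: ideal A] #<= `I_n)%card.
Definition has_num_ideals (n : nat) : Prop := ([set: ideal A] #= `I_n)%card.

Definition principal_ideal I : Prop :=
  exists a : A, (I : set A) = [set b * a | b in [set: A]].

Definition principal_ideal_ring : Prop := forall I, principal_ideal I.

Definition multiplication_ideal I : Prop :=
  forall J, J `<=` I -> exists K, J = ideal_mul I K.

Definition multiplication_ring : Prop := forall I, multiplication_ideal I.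

End RingPredicates.

Section DirectProduct.
Variables (T : finType) (A : T -> comPzRingType).
Local Notation prodA := {dffun forall i, A i}.
Implicit Types x y z : prodA.

Definition dprod_zero : prodA := [ffun i => 0].
Definition dprod_opp x : prodA := [ffun i => - x i].
Definition dprod_add x y : prodA := [ffun i => x i + y i].
Definition dprod_one : prodA := [ffun i => 1].
Definition dprod_mul x y : prodA := [ffun i => x i * y i].

Lemma dprod_addA : associative dprod_add.
Proof. by move=> x y z; apply/ffunP => i; rewrite !ffunE addrA. Qed.

Lemma dprod_addC : commutative dprod_add.
Proof. by move=> x y; apply/ffunP => i; rewrite !ffunE addrC. Qed.

Lemma dprod_add0 : left_id dprod_zero dprod_add.
Proof. by move=> x; apply/ffunP => i; rewrite !ffunE add0r. Qed.

Lemma dprod_addN : left_inverse dprod_zero dprod_opp dprod_add.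
Proof. by move=> x; apply/ffunP => i; rewrite !ffunE addNr. Qed.

HB.instance Definition _ := GRing.isZmodule.Build prodA
  dprod_addA dprod_addC dprod_add0 dprod_addN.

Lemma dprod_mulA : associative dprod_mul.
Proof. by move=> x y z; apply/ffunP => i; rewrite !ffunE mulrA. Qed.

Lemma dprod_mulC : commutative dprod_mul.
Proof. by move=> x y; apply/ffunP => i; rewrite !ffunE mulrC. Qed.

Lemma dprod_mul1 : left_id dprod_one dprod_mul.
Proof. by move=> x; apply/ffunP => i; rewrite !ffunE mul1r. Qed.

Lemma dprod_mulDl : left_distributive dprod_mul dprod_add.
Proof. by move=> x y z; apply/ffunP => i; rewrite !ffunE mulrDl. Qed.

HB.instance Definition _ := GRing.Zmodule_isComPzRing.Build prodA
  dprod_mulA dprod_mulC dprod_mul1 dprod_mulDl.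

Definition direct_product : comPzRingType := prodA.

End DirectProduct.

(* Main.v *)
Require Import Defs.
From mathcomp Require Import all_boot all_order all_algebra.
From mathcomp Require Import boolp classical_sets functions cardinality.

(** The whole theorem follows from one counting fact: a ring with at most five
    ideals is a principal ideal ring ([few_ideals_principal]).  If the ideal
    [(x, y)] is not principal, then the six ideals [0], [(x)], [(y)],
    [(x + y)], [(x, y)] and [A] are pairwise distinct, because any two of the
    elements [x], [y], [x + y] generate [(x, y)].  And a ring with finitely
    many ideals that has a non-principal ideal also has a non-principal ideal
    with two generators, since otherwise one could enlarge a principal
    subideal of the given ideal forever ([principal_of_two_generated]).

    If [I = (a)] is principal, then [I (J : I) = I `&` J] for every [J]:
    an element [b * a] of [J] has [b] in [(J : I)] ([principal_divisible]).
    This gives divisibility for rings with at most five ideals, and also that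
    principal ideal rings are multiplication rings, with [(J : I)] as the
    cofactor of [J].  Finally a finite product of principal ideal rings is
    a principal ideal ring: the generators of the projections of an ideal are
    assembled with the idempotents of the product
    ([direct_product_principal]). *)

Set Implicit Arguments.
Unset Strict Implicit.
Unset Printing Implicit Defensive.

Import Order.TTheory GRing.Theory.

(** * The residuated lattice of ideals *)

Section IdealLattice.
Local Open Scope classical_set_scope.
Local Open Scope ring_scope.
Variable A : comPzRingType.
Implicit Types (I J K : ideal A) (x y z : A).

Lemma ideal_leP I J : reflect (I `<=` J) (I <= J)%O.
Proof. exact: asboolP. Qed.

Lemma mem_ideal_mul I J x y :
  ideal_set I x -> ideal_set J y -> ideal_set (ideal_mul I J) (x * y).
Proof.
by move=> Ix Jy; exists 1%N, (fun=> x), (fun=> y); split; rewrite ?big_ord1.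
Qed.

Lemma ideal_sum_mem I n (f : 'I_n -> A) :
  (forall k, ideal_set I (f k)) -> ideal_set I (\sum_(k < n) f k).
Proof.
by move=> If; apply: (big_ind (ideal_set I)) => //;
  [exact: ideal0 | exact: idealD].
Qed.

Lemma ideal_mul_leP I J K :
  (ideal_mul I J <= K)%O <->
  (forall x y, ideal_set I x -> ideal_set J y -> ideal_set K (x * y)).
Proof.
split=> [/ideal_leP sub x y Ix Jy|mulK].
  exact/sub/mem_ideal_mul.
apply/ideal_leP => _ [n [f [g [If Jg ->]]]].
by apply: ideal_sum_mem => k; apply: mulK.
Qed.

Lemma ideal_residuation I J K :
  (K <= ideal_imp I J)%O <-> (ideal_mul I K <= J)%O.
Proof.
rewrite ideal_mul_leP; split=> [/ideal_leP sub x y Ix Ky|mulJ].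
  by rewrite mulrC; apply: (sub y Ky).
by apply/ideal_leP => y Ky x Ix; rewrite mulrC; apply: mulJ.
Qed.

Lemma ideal_mulC : commutative (@ideal_mul A).
Proof.
suff sub I J : (ideal_mul I J <= ideal_mul J I)%O.
  by move=> I J; apply/le_anti; rewrite !sub.
by apply/ideal_mul_leP => x y Ix Jy; rewrite mulrC; apply: mem_ideal_mul.
Qed.

(** Residuation moves the outer factor to the right of [<=], so that each
    product only has to be tested on products of elements. *)
Lemma ideal_mulA : associative (@ideal_mul A).
Proof.
have sub I J K :
    (ideal_mul I (ideal_mul J K) <= ideal_mul (ideal_mul I J) K)%O.
  apply/ideal_residuation/ideal_mul_leP => y z Jy Kz x Ix.
  by rewrite mulrC mulrA; do 2?apply: mem_ideal_mul.
move=> I J K; apply/le_anti; rewrite sub /=.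
rewrite ideal_mulC (ideal_mulC I J) (ideal_mulC I) (ideal_mulC J K).
exact: sub.
Qed.

Lemma ideal_mul1 : left_id \top%O (@ideal_mul A).
Proof.
move=> I; apply/le_anti/andP; split.
  by apply/ideal_mul_leP => x y _; apply: idealM.
by apply/ideal_leP => x Ix; rewrite -[x]mul1r; apply: mem_ideal_mul.
Qed.

Lemma ideal_le_mul I J K : (J <= K)%O -> (ideal_mul I J <= ideal_mul I K)%O.
Proof.
move=> /ideal_leP JK; apply/ideal_mul_leP => x y Ix Jy.
by apply: mem_ideal_mul => //; apply: JK.
Qed.

Lemma ideal_residuated_lattice :
  residuated_lattice (@ideal_mul A) (@ideal_imp A).
Proof.
split.
- exact: ideal_mulA.
- exact: ideal_mulC.
- exact: ideal_mul1.
- by move=> K I J; apply: ideal_le_mul.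
- by move=> I J K; apply: ideal_residuation.
Qed.

(** An element of [I `&` J] has the form [b * a], with [a] the generator of
    [I], and then [b] multiplies all of [I] into [J]. *)
Lemma principal_divisible I J :
  principal_ideal I -> ideal_mul I (ideal_imp I J) = (I `&` J)%O.
Proof.
move=> [a Ia]; apply/le_anti/andP; split.
  rewrite lexI; apply/andP; split; last exact/ideal_residuation.
  by apply/ideal_mul_leP => x y Ix _; rewrite mulrC; apply: idealM.
apply/ideal_leP => x [] Ix Jx; have := Ix; rewrite Ia => -[b _ ba].
rewrite -ba mulrC; apply: mem_ideal_mul.
  by rewrite Ia; exists 1; rewrite ?mul1r.
move=> i; rewrite Ia => -[c _ <-].
by rewrite mulrCA ba; apply: idealM.
Qed.

Lemma principal_ring_divisible : principal_ideal_ring A ->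
  divisible_residuated_lattice (@ideal_mul A) (@ideal_imp A).
Proof.
move=> pirA; split; first exact: ideal_residuated_lattice.
by move=> I J; apply: principal_divisible.
Qed.

Lemma principal_ring_multiplication :
  principal_ideal_ring A -> multiplication_ring A.
Proof.
move=> pirA I J /ideal_leP sJI; exists (ideal_imp I J).
by rewrite principal_divisible //; apply/esym/meet_idPr.
Qed.

End IdealLattice.

(** * Rings with few ideals *)

Section FewIdeals.
Local Open Scope classical_set_scope.
Local Open Scope ring_scope.
Variable A : comPzRingType.
Implicit Types (I J K : ideal A) (x y z : A).

Lemma gen1_subproof x : is_ideal [set b * x | b in [set: A]].
Proof.
split=> [|_ _ [b _ <-] [c _ <-]|a _ [b _ <-]].
- by exists 0; rewrite ?mul0r.
- by exists (b + c); rewrite ?mulrDl.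
- by exists (a * b); rewrite ?mulrA.
Qed.
Definition gen1 x : ideal A := Ideal (gen1_subproof x).

Definition gen2 x y : ideal A := (gen1 x `|` gen1 y)%O.

Lemma gen1_le x I : (gen1 x <= I)%O <-> ideal_set I x.
Proof.
split=> [/ideal_leP|Ix]; first by apply; exists 1; rewrite ?mul1r.
by apply/ideal_leP => _ [b _ <-]; apply: idealM.
Qed.

Lemma mem_gen1 x : ideal_set (gen1 x) x.
Proof. exact/gen1_le. Qed.

Lemma gen2_le x y I :
  (gen2 x y <= I)%O <-> ideal_set I x /\ ideal_set I y.
Proof.
rewrite leUx -!gen1_le; split=> [/andP//|[Ix Iy]]; exact/andP.
Qed.

Lemma mem_gen2 x y : ideal_set (gen2 x y) x /\ ideal_set (gen2 x y) y.
Proof. exact/gen2_le. Qed.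

Lemma principal_gen1 x : principal_ideal (gen1 x).
Proof. by exists x. Qed.

Lemma principal_gen1P I : principal_ideal I -> exists x, I = gen1 x.
Proof. by move=> [x Ix]; exists x; apply: ideal_inj. Qed.

Lemma gen2_principal x y z :
  ideal_set (gen1 z) x -> ideal_set (gen1 z) y -> ideal_set (gen2 x y) z ->
  principal_ideal (gen2 x y).
Proof.
move=> zx zy xyz; suff -> : gen2 x y = gen1 z by exact: principal_gen1.
by apply/le_anti/andP; split; [apply/gen2_le | apply/gen1_le].
Qed.

Lemma at_most_ideals_size n (s : seq (ideal A)) :
  at_most_ideals A n -> uniq s -> (size s <= n)%N.
Proof.
move=> leAn us; apply: leq_trans (geq_card_fset_set leAn).
have finA : finite_set [set: ideal A] := card_le_finite leAn (finite_II n).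
by apply: uniq_leq_size us _ => I _; rewrite in_fset_set // inE.
Qed.

(** If every two-generated ideal is principal, a non-principal ideal [I]
    contains arbitrarily long strict chains of principal ideals:
    a generator [x] can be replaced by a generator of [(x, y)] for any [y] of
    [I] outside [(x)]. *)
Lemma principal_of_two_generated n : at_most_ideals A n ->
  (forall x y, principal_ideal (gen2 x y)) -> principal_ideal_ring A.
Proof.
move=> leAn pgen2 I; apply: contrapT => npI.
suff chain m : exists2 x, ideal_set I x & exists s : seq (ideal A),
    [/\ size s = m, uniq s & all (fun K => K < gen1 x)%O s].
  have [x _ [s [sz us _]]] := chain n.+1.
  by have := at_most_ideals_size leAn us; rewrite sz ltnn.
elim: m => [|m [x Ix [s [sz us ltx]]]].
  by exists 0; [exact: ideal0 | exists [::]].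
have [y Iy nxy] : exists2 y, ideal_set I y & ~ ideal_set (gen1 x) y.
  apply: contrapT => noy; apply: npI.
  suff -> : I = gen1 x by exact: principal_gen1.
  apply/le_anti/andP; split; last exact/gen1_le.
  apply/ideal_leP => y Iy; apply: contrapT => nxy.
  by apply: noy; exists y.
have [z xyz] := principal_gen1P (pgen2 x y).
have [zx zy] : ideal_set (gen1 z) x /\ ideal_set (gen1 z) y.
  by rewrite -xyz; exact: mem_gen2.
have ltxz : (gen1 x < gen1 z)%O.
  rewrite lt_neqAle; apply/andP; split; last exact/gen1_le.
  by apply: contra_notN nxy => /eqP ->.
exists z.
  by apply/gen1_le; rewrite -xyz; apply/gen2_le.
exists (gen1 x :: s); split=> /=; first by rewrite sz.
  rewrite us andbT; apply/negP => xs.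
  by have := allP ltx _ xs; rewrite /= ltxx.
rewrite ltxz; apply: sub_all ltx => K ltKx; exact: lt_trans ltKx ltxz.
Qed.

(** When [(x, y)] is not principal, the six ideals [0], [(x)], [(y)],
    [(x + y)], [(x, y)] and [A] are told apart by which of the elements [x],
    [y], [x + y] and [1] they contain.  An ideal containing two of the first
    three elements contains [(x, y)], so none of [(x)], [(y)], [(x + y)] does,
    nor are [x], [y], [x + y] zero; and [1] is outside [(x, y)], since [A] is
    principal. *)
Lemma few_ideals_two_generated x y :
  at_most_ideals A 5 -> principal_ideal (gen2 x y).
Proof.
move=> leA5; apply: contrapT => np.
have [mx my] := mem_gen2 x y.
have mxy : ideal_set (gen2 x y) (x + y) by exact: idealD.
have npgen z : ideal_set (gen2 x y) z ->
    ideal_set (gen1 z) x -> ideal_set (gen1 z) y -> False.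
  by move=> mz zx zy; apply: np; apply: gen2_principal zx zy mz.
have subl I : ideal_set I x -> ideal_set I (x + y) -> ideal_set I y.
  move=> Ix Ixy; rewrite -[y](addKr x) -mulN1r.
  by apply: idealD Ixy; apply: idealM.
have subr I : ideal_set I y -> ideal_set I (x + y) -> ideal_set I x.
  move=> Iy Ixy; rewrite -[x](addrK y) -mulN1r.
  by apply: idealD Ixy _; apply: idealM.
have nxy : ~ ideal_set (gen1 x) y by exact: npgen mx (mem_gen1 x).
have nyx : ~ ideal_set (gen1 y) x.
  by move=> h; exact: npgen my h (mem_gen1 y).
have nxs : ~ ideal_set (gen1 x) (x + y).
  by move=> h; apply: nxy; apply: subl h; apply: mem_gen1.
have nys : ~ ideal_set (gen1 y) (x + y).
  by move=> h; apply: nyx; apply: subr h; apply: mem_gen1.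
have nsx : ~ ideal_set (gen1 (x + y)) x.
  by move=> h; apply: (npgen _ mxy h); apply: subl h (mem_gen1 _).
have nsy : ~ ideal_set (gen1 (x + y)) y.
  by move=> h; apply: nsx; apply: subr h (mem_gen1 _).
have n0 I z : ~ ideal_set I z -> ~ ideal_set (ideal_zero A) z.
  by move=> nIz z0; apply: nIz; rewrite z0; apply: ideal0.
have n1 : ~ ideal_set (gen2 x y) 1.
  move=> h; apply: np; apply: (@gen2_principal _ _ 1) => //.
    by rewrite -[x]mulr1; apply/idealM/mem_gen1.
  by rewrite -[y]mulr1; apply/idealM/mem_gen1.
have n1gen z : ideal_set (gen2 x y) z -> ~ ideal_set (gen1 z) 1.
  by move=> /gen1_le/ideal_leP sub /sub.
have n10 : ~ ideal_set (ideal_zero A) 1 by exact: n0 n1.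
pose s := [:: ideal_zero A; gen1 x; gen1 y; gen1 (x + y); gen2 x y;
              ideal_full A].
pose mems I := [:: `[< ideal_set I x >]; `[< ideal_set I y >];
                   `[< ideal_set I (x + y) >]; `[< ideal_set I 1 >]].
have mems_s : map mems s =
    [:: [:: false; false; false; false]; [:: true;  false; false; false];
        [:: false; true;  false; false]; [:: false; false; true;  false];
        [:: true;  true;  true;  false]; [:: true;  true;  true;  true]].
  rewrite /s !map_cons /mems.
  rewrite !(asboolF (n0 _ _ nyx), asboolF (n0 _ _ nxy), asboolF (n0 _ _ nxs)).
  rewrite !(asboolF nxy, asboolF nxs, asboolF nyx, asboolF nys).
  rewrite !(asboolF nsx, asboolF nsy, asboolF n1, asboolF n10).
  rewrite !(asboolF (n1gen _ mx), asboolF (n1gen _ my), asboolF (n1gen _ mxy)).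
  rewrite !(asboolT (mem_gen1 _), asboolT mx, asboolT my, asboolT mxy).
  by rewrite !asboolT.
suff us : uniq s by have := at_most_ideals_size leA5 us.
by apply: (@map_uniq _ _ mems); rewrite mems_s.
Qed.

Lemma few_ideals_principal : at_most_ideals A 5 -> principal_ideal_ring A.
Proof.
move=> leA5; apply: principal_of_two_generated (leA5) _ => x y.
exact: few_ideals_two_generated.
Qed.

End FewIdeals.

(** * Finite direct products *)

Section Product.
Local Open Scope classical_set_scope.
Local Open Scope ring_scope.
Variables (T : finType) (A : T -> comPzRingType).
Local Notation P := (direct_product A).

Definition coord (i : T) (x : P) : A i := (x : {dffun forall i, A i}) i.

Lemma coordD i (x y : P) : coord i (x + y) = coord i x + coord i y.
Proof. by rewrite /coord ffunE. Qed.

Lemma coordM i (x y : P) : coord i (x * y) = coord i x * coord i y.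
Proof. by rewrite /coord ffunE. Qed.

Lemma coord0 i : coord i 0 = 0.
Proof. by rewrite /coord ffunE. Qed.

Definition tuple_of (f : forall i, A i) : P :=
  ([ffun i => f i] : {dffun forall i, A i}).

Lemma coord_tuple_of f i : coord i (tuple_of f) = f i.
Proof. by rewrite /coord ffunE. Qed.

Lemma coord_inj (x y : P) : (forall i, coord i x = coord i y) -> x = y.
Proof. by move=> exy; apply/ffunP. Qed.

Definition idem (i : T) : P := tuple_of (fun j => (j == i)%:R).

Lemma sum_idem (f : T -> P) i :
  coord i (\sum_j idem j * f j) = coord i (f i).
Proof.
rewrite (big_morph (coord i) (coordD i) (coord0 i)) (bigD1 i) //= big1.
  by rewrite coordM coord_tuple_of eqxx mul1r addr0.
move=> j ji; rewrite coordM coord_tuple_of eq_sym (negPf ji).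
by rewrite mul0r.
Qed.

Lemma proj_subproof (I : ideal P) i : is_ideal [set coord i x | x in I].
Proof.
split=> [|_ _ [x Ix <-] [y Iy <-]|a _ [x Ix <-]].
- by exists 0; [exact: ideal0 | exact: coord0].
- by exists (x + y); [exact: idealD | exact: coordD].
- exists (tuple_of (dfwith (fun j => 0 : A j) a) * x); first exact: idealM.
  by rewrite coordM coord_tuple_of dfwith_in.
Qed.
Definition proj (I : ideal P) i : ideal (A i) := Ideal (proj_subproof I i).

(** If [g i] in [I] projects to a generator of [proj I i], then the element
    [\sum_i idem i * g i] of [I] has all these generators as coordinates, and
    a multiple of it is obtained by choosing each coordinate separately. *)
Lemma direct_product_principal :
  (forall i, principal_ideal_ring (A i)) -> principal_ideal_ring P.
Proof.
move=> pirA I.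
have genI i : exists2 x, ideal_set I x & proj I i = gen1 (coord i x).
  have [a projIi] := principal_gen1P (pirA i (proj I i)).
  have [x Ix xa] : ideal_set (proj I i) a by rewrite projIi; apply: mem_gen1.
  by exists x; rewrite ?xa.
pose g i := sval (cid2 (genI i)).
have Ig i : ideal_set I (g i) by rewrite /g; case: cid2.
have projg i : proj I i = gen1 (coord i (g i)) by rewrite /g; case: cid2.
pose a : P := \sum_i idem i * g i.
have Ia : ideal_set I a.
  apply: (big_ind (ideal_set I)) => [||i _]; first exact: ideal0.
    exact: idealD.
  exact: idealM.
exists a; apply/seteqP; split=> [x Ix|_ [b _ <-]]; last exact: idealM.
have multx i : exists c, c * coord i (g i) = coord i x.
  have : ideal_set (proj I i) (coord i x) by exists x.
  by rewrite projg => -[c _ ca]; exists c.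
exists (tuple_of (fun i => sval (cid (multx i)))) => //.
apply: coord_inj => i; rewrite coordM coord_tuple_of sum_idem.
by case: cid.
Qed.

End Product.

(** * Divisibility and principality *)

Theorem mainTheorem7 :
  (forall A : comPzRingType, at_most_ideals A 5 ->
     divisible_residuated_lattice (@ideal_mul A) (@ideal_imp A))
  /\
  (forall (q : nat) (A : 'I_q -> comPzRingType), (0 < q)%N ->
     (forall i : 'I_q, exists2 n : nat,
        n \in [:: 2; 3; 5] & has_num_ideals (A i) n) ->
     principal_ideal_ring (direct_product A) /\
     multiplication_ring (direct_product A)).
Proof.
split=> [A leA5|q A _ numA].
  exact/principal_ring_divisible/few_ideals_principal.
have pirA : principal_ideal_ring (direct_product A).
  apply: direct_product_principal => i; apply: few_ideals_principal.
  have [n n235 /card_eqPle[leAn _]] := numA i.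
  apply: (card_le_trans leAn); rewrite card_le_II.
  by move: n235; rewrite !inE => /or3P[] /eqP ->.
by split=> //; apply: principal_ring_multiplication.
Qed.
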